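(* Let $\mathcal L=\langle\mathcal M^+,\mathcal M^-\rangle$ be an irreducible and nonnegative nonsquare system with $n$ entities and $m$ affectors. Let $r(\mathcal L)$ be its generalized Perron--Frobenius root and $\overline P(\mathcal L)$ its generalized Perron--Frobenius vector. Then: (Q1) $r(\mathcal L)>0$. (Q2) $\overline P(\mathcal L)\ge 0$. (Q3) $|NZ(\overline P(\mathcal L))|=n$. (Q4) $\overline P(\mathcal L)$ is not unique. (Q5) The generalized Perron root of $\mathcal L$ satisfies $r(\mathcal L)=\min_{\overline X\in\mathcal N}\mathfrak f(\overline X)$, where $$\mathfrak f(\overline X)=\max_{1\le i\le n,\ (\mathcal M^+\overline X)_i\neq 0}\left\{\frac{(\mathcal M^-\overline X)_i}{(\mathcal M^+\overline X)_i}\right\},\qquad \mathcal N=\{\overline X\in\mathbb R^m:\ \overline X\ge 0,\ \|\overline X\|_1=1,\ \mathcal M^+\overline X\ne 0\}.$$ That is, the Perron--Frobenius eigenvalue $r(\mathcal L)$ is $1/\beta^*$, where $\beta^*$ is the optimal value of the program: maximize $\beta$ subject to $\mathcal M^-\overline X\le\frac1\beta\,\mathcal M^+\overline X$, $\overline X\ge\overline 0$, $\|\overline X\|_1=1$; and the Perron--Frobenius vector $\overline P(\mathcal L)$ is the corresponding optimal point. Hence for $\beta^*$, the $n$ constraints $\mathcal M^-\overline X\le\frac1{\beta^*}\,\mathcal M^+\overline X$ hold with equality.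
   Context: System: let $n\le m$ be positive integers. A system has entities $v_1,\dots,v_n$, affectors $\mathcal A_1,\dots,\mathcal A_m$ and real gains $g(i,j)$, $1\le i\le n$, $1\le j\le m$. Its supporters and repressors gain matrices are the $n\times m$ nonnegative matrices $\mathcal M^+(i,j)=\max\{g(i,j),0\}$ and $\mathcal M^-(i,j)=\max\{-g(i,j),0\}$, and the system is $\mathcal L=\langle\mathcal M^+,\mathcal M^-\rangle$. Put $\mathcal S_i=\{\mathcal A_j: g(i,j)>0\}$ (supporters of $v_i$). Standing assumptions: $\mathcal S_i\neq\emptyset$ for every $i$, and there are no redundant affectors, i.e. for every $j$ there is $i$ with $g(i,j)>0$. A system is square if $m\le n$ and $|\mathcal S_i|=1$ for all $i$, and nonsquare otherwise. For $\overline X\in\mathbb R^m$ with $\overline X\ge 0$, $NZ(\overline X)=\{\mathcal A_j: X(j)>0\}$. Vector inequalities are componentwise. Selections: a matrix $F\in\{0,1\}^{m\times n}$ is a legal selection matrix for $\mathcal L$ if for every $i$ there is exactly one $j$ with $F(j,i)=1$, and for this $j$ one has $\mathcal A_j\in\mathcal S_i$. $\mathcal F(\mathcal L)$ is the set of legal selection matrices. For $F\in\mathcal F(\mathcal L)$ put $\mathcal L(F)=\langle \mathcal M^+F,\mathcal M^-F\rangle$ (column $i$ of $\mathcal M^{\pm}F$ is the column of $\mathcal M^{\pm}$ of the supporter selected for $v_i$). Irreducibility: a nonnegative square matrix $C$ is irreducible if for all $i,j$ there is a natural number $k$ with $(C^k)_{i,j}>0$. The system $\mathcal L$ is irreducible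 if for every $F\in\mathcal F(\mathcal L)$ the matrix $\mathcal M^+F$ is nonsingular and the matrix $\mathcal M^-F$ is irreducible. Generalized Perron--Frobenius root and vector of an irreducible system: $Z(\mathcal L(F))=(\mathcal M^+F)^{-1}\mathcal M^-F$; $r(\mathcal L(F))$ is the largest real eigenvalue of $Z(\mathcal L(F))$, and $\overline P(\mathcal L(F))\in\mathbb R^n$ is the Perron vector of $Z(\mathcal L(F))$ (the positive eigenvector for $r(\mathcal L(F))$ with $\ell_1$ norm $1$). Define $r(\mathcal L)=\min_{F\in\mathcal F(\mathcal L)}r(\mathcal L(F))$. For a selection matrix $F^*$ attaining the minimum, $\overline P(\mathcal L)\in\mathbb R^m$ is the vector whose entry at an affector $\mathcal A_j$ selected by $F^*$ (i.e. $\sum_iF^*(j,i)>0$) is the entry of $\overline P(\mathcal L(F^* ))$ corresponding to $\mathcal A_j$, and whose other entries are $0$.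
   Formalization: f is taken to be +∞ when some row has zero (M⁺X)_i but positive (M⁻X)_i (else the minimum is 0); (Q4) is stated as: some irreducible nonsquare system of the same dimensions has two Perron vectors (a given L may have only one); irreducibility uses k ≥ 1. *)

(* Defs.v *)
From mathcomp Require Import all_boot all_order all_algebra.
From mathcomp Require Import reals constructive_ereal.

Set Implicit Arguments.
Unset Strict Implicit.
Unset Printing Implicit Defensive.

Import Order.TTheory GRing.Theory Num.Theory.

Local Open Scope ring_scope.

(** ** Systems, given by their gain matrix [g] (entities x affectors) *)

Section Systems.
Variables (R : realType) (n m : nat).
Implicit Types (g : 'M[R]_(n, m)) (F : 'M[R]_(m, n)).

Definition Mplus g : 'M[R]_(n, m) := \matrix_(i, j) Num.max (g i j) 0.

Definition Mminus g : 'M[R]_(n, m) := \matrix_(i, j) Num.max (- g i j) 0.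

Definition supporters g (i : 'I_n) : {set 'I_m} := [set j | 0 < g i j].

Definition system g : Prop :=
  (forall i, supporters g i != set0) /\
  (forall j, exists i, j \in supporters g i).

Definition square_system g : Prop :=
  (m <= n)%N /\ forall i, #|supporters g i| = 1%N.

Definition legal_selection g F : Prop :=
  [/\ forall j i, F j i = 0 \/ F j i = 1,
      forall i, exists! j, F j i = 1
    & forall i j, F j i = 1 -> j \in supporters g i].

End Systems.

(** The exponent is taken positive: with exponent 0 allowed, the 1 x 1 zero
    matrix would be irreducible although its Perron root is 0. *)
Definition irreducible_mx (R : realType) (n : nat) (C : 'M[R]_n) : Prop :=
  forall i j, exists2 k, (0 < k)%N & 0 < (C ^+ k) i j.

Definition irreducible_system (R : realType) (n m : nat)
    (g : 'M[R]_(n, m)) : Prop :=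
  forall F, legal_selection g F ->
    Mplus g *m F \in unitmx /\ irreducible_mx (Mminus g *m F).

Definition norm1 (R : realType) (k : nat) (X : 'cV[R]_k) : R :=
  \sum_i `|X i 0|.

(** ** Perron root and vector *)

Definition perron_root (R : realType) (n : nat) (Z : 'M[R]_n) (r : R) : Prop :=
  eigenvalue Z r /\ forall s, eigenvalue Z s -> s <= r.

Definition perron_vector (R : realType) (n : nat) (Z : 'M[R]_n)
    (p : 'cV[R]_n) : Prop :=
  exists r, [/\ perron_root Z r, Z *m p = r *: p,
                forall i, 0 < p i 0 & norm1 p = 1].

Section GeneralizedPerron.
Variables (R : realType) (n m : nat).
Implicit Types (g : 'M[R]_(n, m)) (F : 'M[R]_(m, n)) (P X : 'cV[R]_m).

Definition Zmx g F : 'M[R]_n := invmx (Mplus g *m F) *m (Mminus g *m F).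

(** [r] is the minimum of the roots of the subsystems [L(F)]; the second clause
    also says that every one of these roots exists. *)
Definition gpf_root g (r : R) : Prop :=
  (exists2 F, legal_selection g F & perron_root (Zmx g F) r) /\
  (forall F, legal_selection g F ->
     exists2 s, perron_root (Zmx g F) s & r <= s).

Definition extends_selected F (p : 'cV[R]_n) P : Prop :=
  (forall j i, F j i = 1 -> P j 0 = p i 0) /\
  (forall j, ~ 0 < \sum_i F j i -> P j 0 = 0).

(** [P] is a generalized Perron vector: one is obtained from every selection
    matrix attaining the minimum. *)
Definition gpf_vector g P : Prop :=
  exists r F p,
    [/\ gpf_root g r, legal_selection g F, perron_root (Zmx g F) r,
        perron_vector (Zmx g F) p & extends_selected F p P].

Definition NZ X : {set 'I_m} := [set j | 0 < X j 0].

(** ** Collatz-Wielandt function and the optimization program *)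

Definition cw_domain g X : Prop :=
  [/\ forall j, 0 <= X j 0, norm1 X = 1 & Mplus g *m X != 0].

Definition cw_max g X : R :=
  \big[Num.max/0]_(i < n | (Mplus g *m X) i 0 != 0)
     ((Mminus g *m X) i 0 / (Mplus g *m X) i 0).

(** A row with a positive numerator over a zero denominator makes the value
    infinite, in accordance with the constraints of the program below, which
    range over all rows.  If such rows were just ignored, the value at every
    vector supported on a single affector would be 0, and so would the minimum. *)
Definition cw g X : \bar R :=
  if [forall i, ((Mplus g *m X) i 0 == 0) ==> ((Mminus g *m X) i 0 == 0)]
  then (cw_max g X)%:E else +oo%E.

Definition feasible g (beta : R) X : Prop :=
  [/\ beta != 0,
      forall i, (Mminus g *m X) i 0 <= beta^-1 * (Mplus g *m X) i 0,
      forall j, 0 <= X j 0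
    & norm1 X = 1].

Definition optimal g (beta : R) X : Prop :=
  feasible g beta X /\
  forall beta' X', feasible g beta' X' -> beta' <= beta.

End GeneralizedPerron.

(* Main.v *)
Require Import Defs.
From mathcomp Require Import all_boot all_order all_algebra.
From mathcomp Require Import reals constructive_ereal.
From mathcomp Require Import boolp classical_sets.
From mathcomp Require Import topology normedtype derive.

Set Implicit Arguments.
Unset Strict Implicit.
Unset Printing Implicit Defensive.

Import Order.TTheory GRing.Theory Num.Theory.
Import numFieldNormedType.Exports.

Local Open Scope ring_scope.

(** The hypothesis that every [Mplus g *m F] is invertible is very strong.  If
    an affector supported two entities, selecting it for both would give two
    equal columns; so the sets of supporters are pairwise disjoint, and every
    affector [j] supports exactly one entity, its owner ([exists_owner]).  A
    selection is then a section [s] of the owner map, [Mplus g *m F] is the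
    diagonal matrix of the gains [g i (s i)], and [Zmx g F] is a nonnegative
    irreducible matrix whose columns can be exchanged one at a time: each
    subsystem is a policy in an optimization problem that is separable over
    the entities.

    Classical Perron-Frobenius theory provides, for each selection, a positive
    root with positive right and left eigenvectors ([perron_pair]).  Take a
    selection of minimal root [r] and rescale its left eigenvector by the gains
    into a positive row [u].  Then [u *m Mminus g >= r *: (u *m Mplus g)]
    holds over all affectors ([dual_certificate]): if it failed at [j],
    reselecting [j] for its owner would strictly lower the root, contrary to
    minimality.  This [u] is an optimal solution of the linear program dual to
    the maximization of [beta].  Pairing it with a nonnegative [X] shows that
    [Mminus g *m X <= c *: (Mplus g *m X)] forces [r <= c]
    ([gpf_root_le_ratio]), and that for [c = r] all constraints are tight
    ([complementary_slackness]).  The Collatz-Wielandt formula and the optimality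
    of the generalized Perron vectors follow, since each such vector [P]
    satisfies [Mminus g *m P = r *: (Mplus g *m P)].

    For non-uniqueness, disjointness of the supporters turns non-squareness
    into the existence of an entity with two supporters.  With gain [1] between an
    affector and its owner and [-1] elsewhere, all selections have the same
    root [n - 1], so the two selections that differ at that entity give two
    generalized Perron vectors with different supports
    ([uniform_not_unique]). *)

(** * Nonnegative and irreducible matrices *)

Section NonnegativeMatrices.
Variable R : realType.

Lemma sumr_gt0_at (I : finType) (F : I -> R) i :
  (forall j, 0 <= F j) -> 0 < F i -> 0 < \sum_j F j.
Proof. by move=> F0 Fi; rewrite (bigD1 i) //= ltr_wpDr ?sumr_ge0. Qed.

Lemma mulmx_ge0 p q s (A : 'M[R]_(p, q)) (B : 'M[R]_(q, s)) :
  (forall i j, 0 <= A i j) -> (forall i j, 0 <= B i j) ->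
  forall i j, 0 <= (A *m B) i j.
Proof. by move=> A0 B0 i j; rewrite mxE sumr_ge0 // => k _; exact: mulr_ge0. Qed.

Lemma exprmx_ge0 n (A : 'M[R]_n) k :
  (forall i j, 0 <= A i j) -> forall i j, 0 <= (A ^+ k) i j.
Proof.
move=> A0; elim: k => [|k IHk] i j; first by rewrite expr0 mxE; case: eqP.
by rewrite exprS; apply: mulmx_ge0.
Qed.

Lemma mulmx_cV_gt0 p q (A : 'M[R]_(p, q)) (x : 'cV[R]_q) :
  (forall i j, 0 < A i j) -> (forall j, 0 <= x j 0) -> x != 0 ->
  forall i, 0 < (A *m x) i 0.
Proof.
move=> A0 x0 xn0 i; have [j xj] : exists j, x j 0 != 0.
  apply/existsP; apply: contra_neqT xn0 => /existsPn xE.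
  apply/matrixP => j k; rewrite ord1 mxE; apply/eqP.
  by have := xE j; rewrite negbK.
rewrite mxE (bigD1 j) //= ltr_wpDr ?sumr_ge0 //.
  by move=> k _; rewrite mulr_ge0 // ltW.
by rewrite mulr_gt0 // lt_def xj x0.
Qed.

(** Irreducibility gives, for each entry, a power of [A] that is positive there;
    the sum of these powers is positive everywhere and commutes with [A].  It is
    used to turn weak inequalities between vectors into strict ones. *)
Lemma irreducible_commuting_positive n (A : 'M[R]_n) :
  (forall i j, 0 <= A i j) -> irreducible_mx A ->
  exists2 B : 'M[R]_n, forall i j, 0 < B i j & A *m B = B *m A.
Proof.
move=> A0 irrA.
have [k /all_and2[_ kP]] : exists k : 'I_n -> 'I_n -> nat,
    forall i, (forall j, 0 < k i j)%N /\ forall j, 0 < (A ^+ k i j) i j.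
  apply: (fin_all_exists (P := fun i (k : 'I_n -> nat) =>
    (forall j, 0 < k j)%N /\ forall j, 0 < (A ^+ k j) i j)) => i.
  have [f f1 f2] := fin_all_exists2 (irrA i).
  by exists f.
exists (\sum_i \sum_j A ^+ k i j) => [i j|].
  rewrite summxE (bigD1 i) //= summxE (bigD1 j) //= -addrA ltr_wpDr ?kP //.
  rewrite addr_ge0 ?sumr_ge0 // => a _; first exact: exprmx_ge0.
  by rewrite summxE sumr_ge0 // => b _; apply: exprmx_ge0.
rewrite mulmx_sumr mulmx_suml; apply: eq_bigr => i _.
rewrite mulmx_sumr mulmx_suml; apply: eq_bigr => j _.
by rewrite -[LHS]/(A * A ^+ _) -[RHS]/(A ^+ _ * A) -exprS -exprSr.
Qed.

(** A positive entry of a power only depends on the pattern of positive entries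
    of the matrix. *)
Lemma irreducible_mono n (A C : 'M[R]_n) :
  (forall i j, 0 <= A i j) -> (forall i j, 0 <= C i j) ->
  (forall i j, 0 < A i j -> 0 < C i j) ->
  irreducible_mx A -> irreducible_mx C.
Proof.
move=> A0 C0 AC irrA i j; have [k k0 Ak] := irrA i j; exists k => //.
elim: k {k0} i j Ak => [|k IHk] i j; first by rewrite !expr0.
rewrite !exprS -![_ * _]/(_ *m _) mxE => Aij.
have [l Al] : exists l, 0 < A i l * (A ^+ k) l j.
  apply/existsP; apply: contraTT Aij => /existsPn Al.
  by rewrite -leNgt sumr_le0 // => l _; rewrite leNgt.
have Ail : 0 < A i l.
  rewrite lt_def A0 andbT; apply: contraTneq Al => ->.
  by rewrite mul0r ltxx.
rewrite pmulr_rgt0 // in Al.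
rewrite mxE (bigD1 l) //= ltr_wpDr ?sumr_ge0 ?mulr_gt0 ?AC ?IHk //.
by move=> a _; rewrite mulr_ge0 // exprmx_ge0.
Qed.

Lemma irreducible_trmx n (A : 'M[R]_n) :
  irreducible_mx A -> irreducible_mx A^T.
Proof.
move=> irrA i j; have [k k0 Ak] := irrA j i; exists k => //.
suff -> : A^T ^+ k = (A ^+ k)^T by rewrite mxE.
elim: k {k0 Ak} => [|k IHk]; first by rewrite !expr0 [RHS]trmx1.
by rewrite exprSr exprS IHk -[_ * A^T]/(_ *m _) -trmx_mul.
Qed.

End NonnegativeMatrices.

(** * The Perron-Frobenius theorem *)

Section PerronFrobenius.
Local Open Scope classical_set_scope.
Local Open Scope ring_scope.
Variable R : realType.

(** Pairing [p] with the entrywise absolute value of any eigenvector [v] for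
    [s], which satisfies [`|v| *m A >= `|s| *: `|v|], gives [`|s| <= r]. *)
Lemma perron_root_of_positive_vector n (A : 'M[R]_n) (p : 'cV[R]_n) r :
  (0 < n)%N ->
  (forall i j, 0 <= A i j) -> (forall i, 0 < p i 0) -> A *m p = r *: p ->
  perron_root A r.
Proof.
move=> n0 A0 p0 Ap; split.
  rewrite /eigenvalue /eigenspace kermx_eq0 row_free_unit.
  apply: contraTN (p0 (Ordinal n0)) => uA; rewrite -[p](mulKmx uA).
  by rewrite mulmxBl Ap mul_scalar_mx subrr mulmx0 mxE ltxx.
move=> s /eigenvalueP[v vA vn0].
pose u : 'rV[R]_n := \row_j `|v 0 j|.
have u0 j : 0 <= u 0 j by rewrite mxE.
have up0 : 0 < (u *m p) 0 0.
  have [j vj] : exists j, v 0 j != 0.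
    apply/existsP; apply: contra_neqT vn0 => /existsPn vE.
    apply/matrixP => k j; rewrite ord1 mxE; apply/eqP.
    by have := vE j; rewrite negbK.
  rewrite mxE (bigD1 j) //= ltr_wpDr ?sumr_ge0 //.
    by move=> k _; rewrite mulr_ge0 // ltW.
  by rewrite mulr_gt0 // mxE normr_gt0.
apply: le_trans (ler_norm s) _; rewrite -(ler_pM2r up0).
have -> : r * (u *m p) 0 0 = (u *m A *m p) 0 0.
  by rewrite -mulmxA Ap -scalemxAr [in RHS]mxE.
rewrite mxE [leRHS]mxE mulr_sumr ler_sum // => j _.
rewrite mulrA ler_wpM2r ?(ltW (p0 j)) //.
rewrite mxE -normrM; have := congr1 (fun w : 'rV_n => w 0 j) vA.
rewrite /= mxE [in RHS]mxE => <-; apply: le_trans (ler_norm_sum _ _ _) _.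
by rewrite mxE ler_sum // => k _; rewrite normrM mxE (ger0_norm (A0 _ _)).
Qed.

Lemma perron_root_uniq n (A : 'M[R]_n) r s :
  perron_root A r -> perron_root A s -> r = s.
Proof. by move=> [e1 h1] [e2 h2]; apply/le_anti; rewrite h1 ?h2. Qed.

(** The Collatz-Wielandt maximum: the pairs [(t, x)] with [x] in the simplex and
    [t *: x <= A *m x] form a compact set once [t] is confined to [[0, S]],
    where [S], the sum of the entries of [A], bounds every such [t]. *)
Lemma max_subeigenvalue n (A : 'M[R]_n) :
  (0 < n)%N -> (forall i j, 0 <= A i j) ->
  exists r, exists2 x : 'cV[R]_n,
    [/\ 0 <= r, forall i, 0 <= x i 0, x != 0
      & forall i, r * x i 0 <= (A *m x) i 0]
    & forall t (y : 'cV[R]_n), (forall i, 0 <= y i 0) -> y != 0 ->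
        (forall i, t * y i 0 <= (A *m y) i 0) -> t <= r.
Proof.
move=> n0 A0.
pose S := \sum_i \sum_j A i j.
have S0 : 0 <= S by rewrite !sumr_ge0 // => i _; rewrite sumr_ge0.
(* The row [v] encodes the pair: [v 0 0] is [t] and [tl v] is [x]. *)
pose tl (v : 'rV[R]_n.+1) : 'cV[R]_n := \col_i v 0 (lift ord0 i).
pose box := [set v : 'rV[R]_n.+1 |
  forall j, `[0, if j == ord0 then S else 1]%classic (v ord0 j)].
pose K := [set v : 'rV[R]_n.+1 | box v /\ \sum_i tl v i 0 = 1 /\
  forall i, 0 <= (A *m tl v) i 0 - v 0 0 * tl v i 0].
have ctl i : continuous (fun v : 'rV[R]_n.+1 => tl v i 0).
  have -> : (fun v => tl v i 0) = (fun v : 'rV[R]_n.+1 => v 0 (lift ord0 i)).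
    by apply/funext => v; rewrite mxE.
  exact: (@coord_continuous R 1 n.+1).
have cv0 : continuous (fun v : 'rV[R]_n.+1 => v 0 0).
  exact: (@coord_continuous R 1 n.+1).
have cA i : continuous
    (fun v : 'rV[R]_n.+1 => (A *m tl v) i 0 - v 0 0 * tl v i 0).
  move=> v; apply: cvgB; [exact: nbhs_filter| |]; last first.
    by apply: cvgM; [exact: nbhs_filter|exact: cv0|exact: ctl].
  have -> : (fun w => (A *m tl w) i 0) = (fun w => \sum_j A i j * tl w j 0).
    by apply/funext => w; rewrite mxE.
  rewrite [X in _ --> X]mxE.
  apply: cvg_big => [||j _]; [exact: add_continuous|exact: nbhs_filter|].
  by apply: cvgM; [exact: nbhs_filter|exact: cst_continuous|exact: ctl].
have csum : continuous (fun v : 'rV[R]_n.+1 => \sum_i tl v i 0).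
  move=> v; apply: cvg_big => [||i _]; [exact: add_continuous|exact: nbhs_filter|].
  exact: ctl.
have KE : K = (box `&` (((fun v => \sum_i tl v i 0) @^-1` [set 1]) `&`
   \bigcap_i ((fun v => (A *m tl v) i 0 - v 0 0 * tl v i 0)
     @^-1` [set y | 0 <= y]))).
  apply/seteqP; split => v [h1 [h2 h3]]; do !split => //.
    by move=> i _; exact: h3.
  by move=> i; exact: (h3 i).
have box_cpt : compact box.
  apply: (@rV_compact _ _ (fun j : 'I_n.+1 => `[0, if j == ord0 then S else 1]%classic)).
  by move=> j; exact: segment_compact.
have Kcpt : compact K.
  apply: (subclosed_compact _ box_cpt); last by move=> v [].
  rewrite KE; apply: closedI; last apply: closedI.
  - by apply: compact_closed box_cpt; exact: norm_hausdorff.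
  - by apply: closed_comp; [move=> v _; exact: csum|exact: closed_eq].
  - apply: closed_bigI => i _.
    by apply: closed_comp; [move=> v _; exact: cA|exact: closed_ge].
have sum_gt0 (y : 'cV[R]_n) : (forall i, 0 <= y i 0) -> y != 0 -> 0 < \sum_i y i 0.
  move=> y0; apply: contra_neqT; rewrite -leNgt => ys.
  apply/matrixP => i j; rewrite ord1 [RHS]mxE; apply/le_anti.
  rewrite y0 andbT; apply: le_trans ys.
  by rewrite (bigD1 i) //= lerDl sumr_ge0.
have mem_K t (y : 'cV[R]_n) : 0 <= t -> (forall i, 0 <= y i 0) -> y != 0 ->
    (forall i, t * y i 0 <= (A *m y) i 0) -> exists2 v, K v & v 0 0 = t.
  move=> t0 y0 yn0 ty; set s := \sum_i y i 0.
  have s0 : 0 < s := sum_gt0 y y0 yn0.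
  have y_le i : y i 0 <= s by rewrite /s (bigD1 i) //= lerDl sumr_ge0.
  pose v : 'rV[R]_n.+1 := \row_j (if unlift ord0 j is Some i then y i 0 / s else t).
  have tlv : tl v = s^-1 *: y.
    by apply/matrixP => i j; rewrite ord1 !mxE liftK mulrC.
  have v0 : v 0 0 = t by rewrite mxE unlift_none.
  exists v => //; split; last split.
  - move=> j; rewrite mxE; case: unliftP => [i ->|->] /=.
      by rewrite /= in_itv /= divr_ge0 ?(ltW s0) //= ler_pdivrMr // mul1r.
    rewrite /= in_itv /= t0 /= -(ler_pM2r s0) mulr_sumr.
    apply: le_trans (ler_sum _ (fun i _ => ty i)) _.
    rewrite /S mulr_suml ler_sum // => i _.
    by rewrite mxE mulr_suml ler_sum // => j0 _; rewrite ler_wpM2l.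
  - under eq_bigr do rewrite tlv mxE.
    by rewrite -mulr_sumr mulVf // gt_eqF.
  - move=> i; rewrite v0 tlv -scalemxAr [in X in X - _]mxE [in X in _ - X]mxE.
    by rewrite mulrCA -mulrBr mulr_ge0 ?invr_ge0 ?(ltW s0) // subr_ge0.
have K0 : K !=set0.
  have one0 : (const_mx 1 : 'cV[R]_n) != 0.
    apply: contraTneq (ltr01 : 0 < 1 :> R) => /matrixP/(_ (Ordinal n0) 0).
    by rewrite !mxE => ->; rewrite ltxx.
  have [i|i|v Kv _] := mem_K 0 (const_mx 1) (lexx 0) _ one0; last by exists v.
    by rewrite mxE.
  by rewrite mul0r; apply: mulmx_ge0 => // a b; rewrite mxE.
have [|v /set_mem[vbox [vsum vA]] vmax] := @EVT_max_rV R _ (fun v => v 0 0) K K0 Kcpt.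
  by exact: continuous_subspaceT.
have r0 : 0 <= v 0 0 by have := vbox ord0; rewrite /= in_itv /= => /andP[].
exists (v 0 0), (tl v).
  split => // [i||i].
  - by have := vbox (lift ord0 i); rewrite /= in_itv /= mxE => /andP[].
  - apply: contra_eq_neq vsum => ->; rewrite big1 ?(eq_sym 0) ?oner_neq0 // => i _.
    by rewrite mxE.
  - by rewrite -subr_ge0.
move=> t y y0 yn0 ty; have [t0|/ltW t0] := leP 0 t; last exact: le_trans r0.
have [w Kw <-] := mem_K t y t0 y0 yn0 ty.
by apply: vmax; exact/mem_set.
Qed.

(** At a maximal pair [(r, x)] with [A *m x != r *: x], a positive [B] commuting
    with [A] makes the defect of [y = B *m x] strictly positive, so that [r]
    could be increased by some [e > 0]; hence [x], and with it the positive
    vector [y], are eigenvectors. *)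
Lemma perron_frobenius n (A : 'M[R]_n) :
  (0 < n)%N -> (forall i j, 0 <= A i j) -> irreducible_mx A ->
  exists2 r, 0 < r &
    exists2 x : 'cV[R]_n, forall i, 0 < x i 0 & A *m x = r *: x.
Proof.
move=> n0 A0 irrA.
have [r [x [r0 x0 xn0 rx] rmax]] := max_subeigenvalue n0 A0.
have [B B0 AB] := irreducible_commuting_positive A0 irrA.
have Bx := mulmx_cV_gt0 B0 x0 xn0.
set y := B *m x in Bx.
have Ax : A *m x = r *: x.
  apply/eqP; rewrite -subr_eq0; apply: contraT => dn0.
  have By : forall i, 0 < (A *m y - r *: y) i 0.
    have -> : A *m y - r *: y = B *m (A *m x - r *: x).
      by rewrite /y mulmxA AB -mulmxA scalemxAr -mulmxBr.
    apply: mulmx_cV_gt0 => // i.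
    by rewrite [leRHS]mxE [in X in _ + X]mxE [in X in _ - X]mxE subr_ge0.
  pose e := \big[Num.min/1]_i ((A *m y - r *: y) i 0 / y i 0).
  have e0 : 0 < e by apply: lt_bigmin => [|i _]; rewrite ?ltr01 ?divr_gt0.
  have yn0 : y != 0.
    by apply: contraTneq (Bx (Ordinal n0)) => ->; rewrite mxE ltxx.
  have /negP[] : ~~ (r + e <= r) by rewrite gerDl -ltNge.
  apply: (rmax _ y) => // i; first exact: ltW.
  rewrite mulrDl -lerBrDl; have : e <= (A *m y - r *: y) i 0 / y i 0.
    exact: bigmin_le_cond.
  rewrite ler_pdivlMr // => /le_trans; apply.
  by rewrite [leLHS]mxE [in X in _ + X]mxE [in X in _ - X]mxE.
have Ay : A *m y = r *: y by rewrite mulmxA AB -mulmxA Ax -scalemxAr.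
exists r; last by exists y.
rewrite lt_def r0 andbT; pose i0 := Ordinal n0.
have [[//|k] _ Ak] := irrA i0 i0.
apply: contraTneq Ak => rE; rewrite exprS.
suff -> : A = 0 by rewrite mul0r mxE ltxx.
apply/matrixP => i j; rewrite [RHS]mxE.
have /eqP := congr1 (fun z : 'cV_n => z i 0) Ay.
rewrite rE scale0r [X in _ == X]mxE mxE psumr_eq0 => [/allP/(_ j)|k' _].
  by rewrite mem_index_enum mulf_eq0 (gt_eqF (Bx j)) orbF => /(_ isT)/eqP.
by rewrite mulr_ge0 // ltW.
Qed.
End PerronFrobenius.

(** * Left and right Perron vectors *)

Section LeftRightPerron.
Variable R : realType.

Lemma mulmx_rV_cV_gt0 n (w : 'rV[R]_n) (p : 'cV[R]_n) :
  (0 < n)%N -> (forall i, 0 < w 0 i) -> (forall i, 0 < p i 0) ->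
  0 < (w *m p) 0 0.
Proof.
move=> n0 w0 p0; rewrite mxE (sumr_gt0_at (i := Ordinal n0)) ?mulr_gt0 // => i.
by rewrite mulr_ge0 // ltW.
Qed.

(** The two roots, obtained from [A] and from its transpose, agree because both
    compute [w *m A *m p]. *)
Lemma perron_pair n (A : 'M[R]_n) :
  (0 < n)%N -> (forall i j, 0 <= A i j) -> irreducible_mx A ->
  exists r, exists p : 'cV[R]_n, exists w : 'rV[R]_n,
    [/\ 0 < r /\ perron_root A r,
        forall i, 0 < p i 0, A *m p = r *: p,
        forall i, 0 < w 0 i & w *m A = r *: w].
Proof.
move=> n0 A0 irrA.
have [r r0 [p p0 Ap]] := perron_frobenius n0 A0 irrA.
have At0 i j : 0 <= A^T i j by rewrite mxE.
have [t _ [w w0 Aw]] := perron_frobenius n0 At0 (irreducible_trmx irrA).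
have wt0 i : 0 < w^T 0 i by rewrite mxE.
have wA : w^T *m A = t *: w^T.
  by rewrite -[A]trmxK -trmx_mul Aw linearZ.
have wp := mulmx_rV_cV_gt0 n0 wt0 p0.
have rt : r = t.
  apply: (mulIf (lt0r_neq0 wp)).
  have : (w^T *m A *m p) 0 0 = (w^T *m A *m p) 0 0 by [].
  by rewrite {2}wA -mulmxA Ap -scalemxAl -scalemxAr [LHS]mxE [RHS]mxE.
exists r, p, w^T; split => //; last by rewrite rt.
by split; last exact: perron_root_of_positive_vector p0 Ap.
Qed.

Lemma norm1_gt0 n (x : 'cV[R]_n) :
  (0 < n)%N -> (forall i, 0 < x i 0) -> 0 < norm1 x.
Proof.
move=> n0 x0; apply: (sumr_gt0_at (i := Ordinal n0)) => //.
by rewrite normr_gt0 gt_eqF.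
Qed.

Lemma perron_vector_exists n (A : 'M[R]_n) r (x : 'cV[R]_n) :
  (0 < n)%N -> perron_root A r -> (forall i, 0 < x i 0) -> A *m x = r *: x ->
  exists p, perron_vector A p.
Proof.
move=> n0 Ar x0 Ax; have s0 := norm1_gt0 n0 x0.
exists ((norm1 x)^-1 *: x), r; split => // [|i|].
- by rewrite -scalemxAr Ax !scalerA mulrC.
- by rewrite mxE mulr_gt0 ?invr_gt0.
- rewrite /norm1; under eq_bigr do rewrite mxE normrM ger0_norm ?invr_ge0 ?ltW //.
  by rewrite -mulr_sumr mulVf // gt_eqF.
Qed.

End LeftRightPerron.

(** * Selections as sections of the owner map *)

Section Selections.
Variables (R : realType) (n m : nat).
Implicit Types (g : 'M[R]_(n, m)) (s : {ffun 'I_n -> 'I_m}) (own : 'I_m -> 'I_n).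

Definition sel_mx s : 'M[R]_(m, n) := \matrix_(j, i) (s i == j)%:R.

Lemma mulmx_sel k (M : 'M[R]_(k, m)) s i a : (M *m sel_mx s) i a = M i (s a).
Proof.
rewrite mxE (bigD1 (s a)) //= mxE eqxx mulr1 big1 ?addr0 // => j js.
by rewrite mxE eq_sym (negbTE js) mulr0.
Qed.

Lemma own_inj own s : (forall i, own (s i) = i) -> injective s.
Proof. by move=> so; exact: can_inj so. Qed.

Lemma mul_sel_cV_in own s (p : 'cV[R]_n) : (forall i, own (s i) = i) ->
  forall i, (sel_mx s *m p) (s i) 0 = p i 0.
Proof.
move=> so i; rewrite mxE (bigD1 i) //= mxE eqxx mul1r big1 ?addr0 // => k ki.
by rewrite mxE (inj_eq (own_inj so)) (negbTE ki) mul0r.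
Qed.

Lemma mul_sel_cV_out s (p : 'cV[R]_n) j : (forall i, s i != j) ->
  (sel_mx s *m p) j 0 = 0.
Proof.
by move=> sj; rewrite mxE big1 // => k _; rewrite mxE (negbTE (sj k)) mul0r.
Qed.

Lemma sel_mx_eq1 s j i : (sel_mx s j i = 1) <-> (s i = j).
Proof.
rewrite mxE; split=> [|->]; last by rewrite eqxx.
by case: eqP => // _ /eqP; rewrite eq_sym oner_eq0.
Qed.

Lemma legal_sel g s :
  (forall i, 0 < g i (s i)) -> legal_selection g (sel_mx s).
Proof.
move=> gs; split=> [j i|i|i j /sel_mx_eq1 <-]; last by rewrite inE.
  by rewrite mxE; case: eqP; [right|left].
exists (s i); split; first exact/sel_mx_eq1.
by move=> j /sel_mx_eq1.
Qed.

Lemma legal_selP g F :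
  legal_selection g F -> exists2 s, F = sel_mx s & forall i, 0 < g i (s i).
Proof.
move=> [F01 F1 Fg].
have [f fP] := fin_all_exists F1.
exists (finfun f); last first.
  by move=> i; have [/Fg + _] := fP i; rewrite inE ffunE.
apply/matrixP => j i; rewrite mxE ffunE; have [Ff Fu] := fP i.
case: eqP => [<-|fj]; first exact: Ff.
by have [|/Fu] := F01 j i.
Qed.

Lemma Mplus_ge0 g i j : 0 <= Mplus g i j.
Proof. by rewrite mxE le_max lexx orbT. Qed.

Lemma Mminus_ge0 g i j : 0 <= Mminus g i j.
Proof. by rewrite mxE le_max lexx orbT. Qed.

Lemma exists_supporters g : system g -> exists s, forall i, 0 < g i (s i).
Proof.
move=> [sup _].
have [c cP] := fin_all_exists (P := fun i j => j \in supporters g i)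
  (fun i => set0Pn _ (sup i)).
by exists (finfun c) => i; have := cP i; rewrite inE ffunE.
Qed.

Definition is_owner g own := forall i j, (0 < g i j) = (own j == i).

(** If [j] supported [i] and also [own j], the selection of [j] for both would
    make two columns of an invertible matrix equal. *)
Lemma exists_owner g :
  system g -> irreducible_system g -> exists own, is_owner g own.
Proof.
move=> sys irr; have [c cP] := exists_supporters sys; have [_ nored] := sys.
have [own ownP] := fin_all_exists nored.
exists own => i j; apply/idP/eqP => [gij|<-]; last by have := ownP j; rewrite inE.
apply/eqP; apply: contraT => ne.
pose s : {ffun 'I_n -> 'I_m} := [ffun k => if (k == i) || (k == own j) then j else c k].
have legal : legal_selection g (sel_mx s).
  apply: legal_sel => k; rewrite ffunE; case: ifPn => [/orP[]/eqP-> //|_].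
    by have := ownP j; rewrite inE.
  exact: cP.
have [uF _] := irr _ legal.
pose d : 'cV[R]_n := delta_mx i 0 - delta_mx (own j) 0.
have same_col : col i (Mplus g *m sel_mx s) = col (own j) (Mplus g *m sel_mx s).
  by apply/matrixP => a b; rewrite mxE [RHS]mxE !mulmx_sel !ffunE !eqxx !orbT.
have /(congr1 (mulmx (invmx (Mplus g *m sel_mx s)))) :
    Mplus g *m sel_mx s *m d = 0.
  by rewrite mulmxBr -!colE same_col subrr.
rewrite mulKmx // mulmx0 => /matrixP/(_ i 0).
by rewrite !mxE !eqxx eq_sym (negbTE ne) subr0 => /eqP; rewrite oner_eq0.
Qed.

Lemma gpf_root_uniq g r t : gpf_root g r -> gpf_root g t -> r = t.
Proof.
move=> [[F Fl Fr] rmin] [[F' F'l F't] tmin]; apply/le_anti.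
have [a /(perron_root_uniq F't) <- ->] := rmin _ F'l.
by have [b /(perron_root_uniq Fr) <- ->] := tmin _ Fl.
Qed.

Section Owned.
Variables (g : 'M[R]_(n, m)) (own : 'I_m -> 'I_n).
Hypothesis ownP : is_owner g own.

Lemma owner_sel s : (forall i, 0 < g i (s i)) <-> (forall i, own (s i) = i).
Proof.
by split=> h i; have := h i; [rewrite ownP => /eqP|rewrite ownP => ->].
Qed.

Lemma MplusE i j : Mplus g i j = if own j == i then g i j else 0.
Proof.
rewrite mxE -ownP; case: ifPn => [/ltW/max_l //|].
by rewrite -leNgt => /max_r.
Qed.

Lemma Mplus_sel s : (forall i, own (s i) = i) ->
  Mplus g *m sel_mx s = diag_mx (\row_i g i (s i)).
Proof.
move=> so; apply/matrixP => i k; rewrite mulmx_sel MplusE so !mxE eq_sym.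
by case: eqP => [->|]; rewrite ?mulr1n ?mulr0n.
Qed.

Lemma Mplus_sel_unit s : (forall i, own (s i) = i) ->
  Mplus g *m sel_mx s \in unitmx.
Proof.
move=> so; rewrite Mplus_sel // unitmxE det_diag unitfE.
apply/prodf_neq0 => i _; have /owner_sel := so.
by rewrite mxE => /(_ i) /lt0r_neq0.
Qed.

Lemma mul_Mplus_Zmx s : (forall i, own (s i) = i) ->
  Mplus g *m sel_mx s *m Zmx g (sel_mx s) = Mminus g *m sel_mx s.
Proof. by move=> so; rewrite mulKVmx // Mplus_sel_unit. Qed.

Lemma ZmxE s i k : (forall i, own (s i) = i) ->
  Zmx g (sel_mx s) i k = Mminus g i (s k) / g i (s i).
Proof.
move=> so; have := congr1 (fun A : 'M_n => A i k) (mul_Mplus_Zmx so).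
rewrite /= Mplus_sel // mul_diag_mx mulmx_sel mxE [X in X * _]mxE => <-.
rewrite mulrC mulKf //; have /owner_sel := so.
by move=> /(_ i) /lt0r_neq0.
Qed.

Lemma Zmx_ge0 s : (forall i, own (s i) = i) ->
  forall i k, 0 <= Zmx g (sel_mx s) i k.
Proof.
move=> so i k; rewrite ZmxE // divr_ge0 ?Mminus_ge0 // ltW //.
by move: i {k}; apply/owner_sel.
Qed.

Lemma irreducible_Zmx s : irreducible_system g -> (forall i, own (s i) = i) ->
  irreducible_mx (Zmx g (sel_mx s)).
Proof.
move=> irr so; have sg := (owner_sel s).2 so.
have [_] := irr _ (legal_sel sg); apply: irreducible_mono.
- by move=> i k; rewrite mulmx_sel Mminus_ge0.
- exact: Zmx_ge0.
- by move=> i k; rewrite mulmx_sel ZmxE // => ?; rewrite divr_gt0.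
Qed.

Lemma exists_selection : system g -> exists s, forall i, own (s i) = i.
Proof.
by case/exists_supporters => s /owner_sel; exists s.
Qed.

(** One step of policy improvement: the owner of [j] switches to [j]. *)
Definition reselect s j : {ffun 'I_n -> 'I_m} :=
  [ffun i => if i == own j then j else s i].

Lemma own_reselect s j : (forall i, own (s i) = i) ->
  forall i, own (reselect s j i) = i.
Proof. by move=> so i; rewrite ffunE; case: eqP => [->|_]. Qed.

Hypothesis n_gt0 : (0 < n)%N.

(** * Generalized root and vector, and linear programming duality *)

Lemma gpf_root_exists : system g -> irreducible_system g ->
  exists r, gpf_root g r.
Proof.
move=> sys irr.
have [rho rhoP] : exists rho : {ffun 'I_n -> 'I_m} -> R, forall s,
    (forall i, own (s i) = i) -> perron_root (Zmx g (sel_mx s)) (rho s).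
  apply: (fin_all_exists (P := fun s r => (forall i, own (s i) = i) ->
    perron_root (Zmx g (sel_mx s)) r)) => s.
  have [/'forall_eqP so|ns] := boolP [forall i, own (s i) == i].
    have [r [p [w [[_ Zr] _ _ _ _]]]] :=
      perron_pair n_gt0 (Zmx_ge0 so) (irreducible_Zmx irr so).
    by exists r.
  by exists 0 => so; case/negP: ns; apply/'forall_eqP.
have [s0 so0] := exists_selection sys.
case: (@arg_minP _ R _ s0 (fun s => [forall i, own (s i) == i]) rho).
  exact/'forall_eqP.
move=> s /'forall_eqP so smin; exists (rho s); split.
  by exists (sel_mx s); [exact/legal_sel/owner_sel|exact: rhoP].
move=> F /legal_selP[t -> /owner_sel to]; exists (rho t); first exact: rhoP.
by apply: smin; apply/'forall_eqP.
Qed.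

(** The support of the resulting vector is recorded, for telling apart the
    vectors of two different selections. *)
Lemma gpf_vector_exists s r : irreducible_system g -> gpf_root g r ->
  (forall i, own (s i) = i) -> perron_root (Zmx g (sel_mx s)) r ->
  exists P, [/\ gpf_vector g P, forall i, 0 < P (s i) 0
    & forall j, (forall i, s i != j) -> P j 0 = 0].
Proof.
move=> irr gr so sr.
have [t [x [_ [[_ Zt] x0 Zx _ _]]]] :=
  perron_pair n_gt0 (Zmx_ge0 so) (irreducible_Zmx irr so).
have [p pP] := perron_vector_exists n_gt0 Zt x0 Zx.
have [_ [_ _ p0 _]] := pP.
have Ps := mul_sel_cV_in p so; have P0 := @mul_sel_cV_out s p.
exists (sel_mx s *m p); split => // [|i]; last by rewrite Ps.
exists r, (sel_mx s), p; split => //; first exact/legal_sel/owner_sel.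
split=> [j i /sel_mx_eq1 <- //|j nj]; apply: P0 => i.
apply/eqP => sj; apply: nj; apply: (sumr_gt0_at (i := i)) => [k|]; first by rewrite mxE.
by rewrite mxE sj eqxx ltr01.
Qed.

Lemma mul_Mplus_gt0 (u : 'rV[R]_n) : (forall i, 0 < u 0 i) ->
  forall j, 0 < (u *m Mplus g) 0 j.
Proof.
move=> u0 j; rewrite mxE; apply: (sumr_gt0_at (i := own j)) => [i|].
  by rewrite mulr_ge0 ?Mplus_ge0 // ltW.
by rewrite mulr_gt0 // MplusE eqxx ownP.
Qed.

(** Dual optimality.  The row [u] is the left Perron eigenvector of an optimal
    selection, divided by its gains, so that equality holds at the selected
    affectors.  A violation at [j] and the right Perron eigenvector [p'] of the
    selection improved at [j] would give a root below the minimum. *)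
Lemma dual_certificate r : irreducible_system g -> gpf_root g r ->
  0 < r /\ exists2 u : 'rV[R]_n, forall i, 0 < u 0 i &
    forall j, r * (u *m Mplus g) 0 j <= (u *m Mminus g) 0 j.
Proof.
move=> irr [[F /legal_selP[s -> sg] Zr] rmin]; have so := (owner_sel s).1 sg.
have [t [p [w [[t0 Zt] _ _ w0 wZ]]]] :=
  perron_pair n_gt0 (Zmx_ge0 so) (irreducible_Zmx irr so).
rewrite (perron_root_uniq Zt Zr) in t0 wZ.
split=> //; pose u : 'rV[R]_n := \row_i (w 0 i / g i (s i)).
have u0 i : 0 < u 0 i by rewrite mxE divr_gt0.
have us : u *m (Mminus g *m sel_mx s) = r *: (u *m (Mplus g *m sel_mx s)).
  have uD : u *m (Mplus g *m sel_mx s) = w.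
    rewrite Mplus_sel //; apply/matrixP => a i; rewrite ord1 mul_mx_diag !mxE.
    by rewrite divfK // lt0r_neq0.
  by rewrite -mul_Mplus_Zmx // mulmxA uD wZ.
exists u => // j; rewrite leNgt; apply/negP => lt_j.
have s'o := own_reselect j so; set s' := reselect s j in s'o.
have s'g := (owner_sel s').2 s'o.
have [t' [p' [_ [[_ Zt'] p'0 Zp' _ _]]]] :=
  perron_pair n_gt0 (Zmx_ge0 s'o) (irreducible_Zmx irr s'o).
have rt' : r <= t'.
  by have [q Zq] := rmin _ (legal_sel s'g); rewrite (perron_root_uniq Zt' Zq).
have Mp' : u *m Mminus g *m sel_mx s' *m p' = t' *: (u *m Mplus g *m sel_mx s' *m p').
  rewrite -(mulmxA u (Mminus g)) -mul_Mplus_Zmx // mulmxA.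
  by rewrite -(mulmxA _ (Zmx _ _)) Zp' -scalemxAr (mulmxA u).
(* The columns kept from [s] are tight; the new one is strictly improved. *)
have uk k : (u *m Mminus g *m sel_mx s') 0 k <= r * (u *m Mplus g *m sel_mx s') 0 k.
  rewrite !mulmx_sel ffunE; case: eqP => _; first exact: ltW.
  have := congr1 (fun v : 'rV_n => v 0 k) us.
  by rewrite /= [RHS]mxE !mulmxA !mulmx_sel => ->.
have : (u *m Mminus g *m sel_mx s' *m p') 0 0 < r * (u *m Mplus g *m sel_mx s' *m p') 0 0.
  rewrite [ltLHS]mxE [X in _ * X]mxE mulr_sumr.
  rewrite (bigD1 (own j)) //= [ltRHS](bigD1 (own j)) //=.
  apply: ltr_leD; last first.
    by apply: ler_sum => k _; rewrite mulrA ler_wpM2r // ltW.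
  by rewrite mulrA ltr_pM2r // !mulmx_sel ffunE eqxx.
have pos : 0 < (u *m Mplus g *m sel_mx s' *m p') 0 0.
  by apply: mulmx_rV_cV_gt0 => // k; rewrite mulmx_sel; exact: mul_Mplus_gt0.
by rewrite Mp' mxE ltr_pM2r // ltNge rt'.
Qed.

Lemma weak_duality r (u : 'rV[R]_n) :
  (forall j, r * (u *m Mplus g) 0 j <= (u *m Mminus g) 0 j) ->
  forall X : 'cV[R]_m, (forall j, 0 <= X j 0) ->
  r * (u *m (Mplus g *m X)) 0 0 <= (u *m (Mminus g *m X)) 0 0.
Proof.
move=> uP X X0; rewrite !mulmxA mxE [leRHS]mxE mulr_sumr ler_sum // => j _.
by rewrite mulrA ler_wpM2r.
Qed.

Lemma gpf_root_le_ratio r c (X : 'cV[R]_m) :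
  irreducible_system g -> gpf_root g r ->
  (forall j, 0 <= X j 0) -> X != 0 ->
  (forall i, (Mminus g *m X) i 0 <= c * (Mplus g *m X) i 0) ->
  r <= c.
Proof.
move=> irr gr X0 Xn0 Xc; have [_ [u u0 uP]] := dual_certificate irr gr.
have pos : 0 < (u *m (Mplus g *m X)) 0 0.
  rewrite mulmxA; apply: mulmx_cV_gt0 => // i j.
  by rewrite ord1; exact: mul_Mplus_gt0.
rewrite -(ler_pM2r pos); apply: le_trans (weak_duality uP X0) _.
rewrite mxE [X in _ * X]mxE mulr_sumr ler_sum // => i _.
by rewrite mulrCA ler_wpM2l // ltW.
Qed.

(** The gaps of the constraints are nonnegative, and by weak duality their sum
    weighted by the positive [u] is at most zero. *)
Lemma complementary_slackness r (X : 'cV[R]_m) :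
  irreducible_system g -> gpf_root g r ->
  (forall j, 0 <= X j 0) ->
  (forall i, (Mminus g *m X) i 0 <= r * (Mplus g *m X) i 0) ->
  forall i, (Mminus g *m X) i 0 = r * (Mplus g *m X) i 0.
Proof.
move=> irr gr X0 Xr i; have [_ [u u0 uP]] := dual_certificate irr gr.
pose gap k := u 0 k * (r * (Mplus g *m X) k 0 - (Mminus g *m X) k 0).
have gap0 k : 0 <= gap k by rewrite mulr_ge0 ?subr_ge0 // ltW.
have sum_gap : \sum_k gap k
    = r * (u *m (Mplus g *m X)) 0 0 - (u *m (Mminus g *m X)) 0 0.
  rewrite mxE [X in _ - X]mxE mulr_sumr -sumrB; apply: eq_bigr => k _.
  by rewrite /gap mulrBr mulrCA.
have /eqP : \sum_k gap k = 0.
  by apply/le_anti; rewrite sumr_ge0 // sum_gap subr_le0 weak_duality.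
rewrite psumr_eq0 // => /allP/(_ i (mem_index_enum _)).
by rewrite mulf_eq0 gt_eqF //= subr_eq0 => /eqP.
Qed.

Lemma gpf_vectorP r P : gpf_root g r -> gpf_vector g P ->
  exists s, exists p : 'cV[R]_n,
    [/\ forall i, own (s i) = i, P = sel_mx s *m p, forall i, 0 < p i 0,
        norm1 p = 1 & Mminus g *m P = r *: (Mplus g *m P)].
Proof.
move=> gr [t [F [p [gt /legal_selP[s -> /owner_sel so] Zt [q [Zq Zp p0 p1]] [Pin Pout]]]]].
rewrite (gpf_root_uniq gt gr) in Zt; rewrite (perron_root_uniq Zq Zt) in Zp.
have PE : P = sel_mx s *m p.
  apply/matrixP => j k; rewrite ord1 {k}.
  have [/existsP[i /eqP <-]|/existsPn sj] := boolP [exists i, s i == j].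
    by rewrite (mul_sel_cV_in _ so); apply: Pin; exact/sel_mx_eq1.
  rewrite mul_sel_cV_out // Pout // big1 ?ltxx // => i _.
  by rewrite mxE (negbTE (sj i)).
exists s, p; split => //.
rewrite PE !mulmxA -mul_Mplus_Zmx // -(mulmxA _ (Zmx _ _)) Zp.
by rewrite -scalemxAr.
Qed.

Lemma mul_sel_norm1 s (p : 'cV[R]_n) : (forall i, 0 <= p i 0) ->
  norm1 (sel_mx s *m p) = norm1 p.
Proof.
move=> p0; have F0 j i : 0 <= sel_mx s j i by rewrite mxE.
transitivity (\sum_j \sum_i sel_mx s j i * p i 0).
  apply: eq_bigr => j _; rewrite mxE ger0_norm // sumr_ge0 // => i _.
  by rewrite mulr_ge0.
rewrite exchange_big; apply: eq_bigr => i _ /=.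
rewrite -mulr_suml (bigD1 (s i)) //= mxE eqxx big1 ?addr0 ?mul1r ?ger0_norm //.
by move=> j js; rewrite mxE eq_sym (negbTE js).
Qed.

Lemma NZ_mul_sel s (p : 'cV[R]_n) : (forall i, own (s i) = i) ->
  (forall i, 0 < p i 0) -> #|NZ (sel_mx s *m p)| = n.
Proof.
move=> so p0.
have -> : NZ (sel_mx s *m p) = s @: [set: 'I_n].
  apply/setP => j; rewrite inE; apply/idP/imsetP => [|[i _ ->]].
    have [/existsP[i /eqP <-]|/existsPn sj] := boolP [exists i, s i == j].
      by exists i.
    by rewrite mul_sel_cV_out ?ltxx.
  by rewrite (mul_sel_cV_in _ so).
by rewrite card_imset ?cardsT ?card_ord //; exact: own_inj so.
Qed.

Lemma Mplus_mul_sel_gt0 s (p : 'cV[R]_n) : (forall i, own (s i) = i) ->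
  (forall i, 0 < p i 0) -> forall i, 0 < (Mplus g *m (sel_mx s *m p)) i 0.
Proof.
move=> so p0 i; rewrite mulmxA Mplus_sel // mul_diag_mx !mxE mulr_gt0 //.
by move: i; apply/owner_sel.
Qed.

Lemma cw_eigenvector r (X : 'cV[R]_m) : 0 < r ->
  (forall i, 0 < (Mplus g *m X) i 0) ->
  Mminus g *m X = r *: (Mplus g *m X) -> cw g X = r%:E.
Proof.
move=> r0 X0 Xr; rewrite /cw ifT; last first.
  by apply/forallP => i; rewrite gt_eqF.
congr (_%:E).
have ratio i : (Mminus g *m X) i 0 / (Mplus g *m X) i 0 = r.
  by rewrite Xr mxE mulfK // gt_eqF.
apply/le_anti/andP; split.
  by apply: bigmax_le => [|i _]; [exact: ltW|rewrite ratio].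
rewrite -[leLHS](ratio (Ordinal n_gt0)).
by apply: (le_bigmax_cond _ (fun i => (Mminus g *m X) i 0 / (Mplus g *m X) i 0));
  rewrite gt_eqF.
Qed.

(** A finite value is a ratio [c] that dominates all the rows, including those
    with a zero denominator, where the numerator vanishes as well. *)
Lemma gpf_root_le_cw r X : irreducible_system g -> gpf_root g r ->
  cw_domain g X -> (r%:E <= cw g X)%E.
Proof.
move=> irr gr [X0 _ MX]; rewrite /cw; case: ifPn => [/forallP fin|_]; last exact: leey.
rewrite lee_fin; apply: (gpf_root_le_ratio irr gr X0) => [|i].
  by apply: contraNneq MX => ->; rewrite mulmx0.
have [Mi|Mi] := eqVneq ((Mplus g *m X) i 0) 0.
  by have := fin i; rewrite Mi eqxx mulr0 => /eqP ->.
have Mi0 : 0 < (Mplus g *m X) i 0.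
  rewrite lt_def Mi; apply: mulmx_ge0 => [a b|a b]; first exact: Mplus_ge0.
  by rewrite ord1.
rewrite -ler_pdivrMr //.
exact: (le_bigmax_cond _ (fun i => (Mminus g *m X) i 0 / (Mplus g *m X) i 0)).
Qed.

Lemma gpf_vector_optimal r P : irreducible_system g ->
  gpf_root g r -> gpf_vector g P -> optimal g r^-1 P.
Proof.
move=> irr gr gP; have [r0 _] := dual_certificate irr gr.
have [s [p [so PE p0 p1 Pr]]] := gpf_vectorP gr gP.
split; first split.
- by rewrite invr_eq0 gt_eqF.
- by move=> i; rewrite invrK Pr mxE.
- move=> j; rewrite PE mulmx_ge0 // => [a b|a b]; first by rewrite mxE.
  by rewrite ord1 ltW.
- by rewrite PE mul_sel_norm1 // => i; rewrite ltW.
move=> b X [_ Xb X0 X1]; have [b0|b0] := leP b 0.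
  by apply: le_trans b0 _; rewrite invr_ge0 ltW.
rewrite -[b]invrK lef_pV2 ?posrE ?invr_gt0 //.
apply: (gpf_root_le_ratio irr gr X0) Xb.
apply: contra_eq_neq X1 => ->; rewrite /norm1 big1 ?(eq_sym 0) ?oner_neq0 // => j _.
by rewrite mxE normr0.
Qed.

(** If [s] inverted the owner map, there would be at most [n] affectors and one
    supporter per entity. *)
Lemma nonsquare_second_supporter s : ~ square_system g ->
  (forall i, own (s i) = i) -> exists j, s (own j) != j.
Proof.
move=> nsq so; apply/existsP; apply: contra_notT nsq => /existsPn sj.
have sK j : s (own j) = j.
  by apply/eqP; have := sj j; rewrite negbK.
split=> [|i].
  by have := leq_card own (can_inj sK); rewrite !card_ord.
apply/eqP/cards1P; exists (s i); apply/setP => j.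
by rewrite !inE ownP; apply/eqP/eqP => [<-|->].
Qed.

End Owned.

(** * Systems with several generalized Perron vectors *)

Section UniformGains.
Variables (own : 'I_m -> 'I_n).

(** Every repression has the same strength as every support, so that all
    selections yield the same matrix: ones off a zero diagonal. *)
Definition uniform_gains : 'M[R]_(n, m) :=
  \matrix_(i, j) if own j == i then 1 else -1.

Lemma uniform_owner : is_owner uniform_gains own.
Proof.
by move=> i j; rewrite mxE; case: eqP => _; rewrite ?ltr01 // oppr_gt0 ltNge ler01.
Qed.

Variable g : 'M[R]_(n, m).
Hypothesis ownP : is_owner g own.

Lemma uniform_supporters i : supporters uniform_gains i = supporters g i.
Proof. by apply/setP => j; rewrite !inE uniform_owner ownP. Qed.

(** Every positive entry of a repressors matrix of [g] stays positive, so
    irreducibility is inherited. *)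
Lemma uniform_irreducible : irreducible_system g -> irreducible_system uniform_gains.
Proof.
move=> irr F /legal_selP[s -> /(owner_sel uniform_owner) so].
split; first exact: (Mplus_sel_unit uniform_owner).
have [_] := irr _ (legal_sel ((owner_sel ownP s).2 so)).
apply: irreducible_mono => i k; rewrite ?mulmx_sel ?Mminus_ge0 //.
rewrite ![Mminus _ _ _]mxE !lt_max !ltxx !orbF oppr_gt0 => gn.
rewrite mxE -ownP; case: ifPn => [/(lt_trans gn)|_]; first by rewrite ltxx.
by rewrite opprK ltr01.
Qed.

Lemma uniform_perron_root s : (0 < n)%N -> (forall i, own (s i) = i) ->
  perron_root (Zmx uniform_gains (sel_mx s)) n.-1%:R.
Proof.
move=> n0 so; apply: (perron_root_of_positive_vector (p := const_mx 1)) => //.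
- exact: Zmx_ge0 uniform_owner _ so.
- by move=> i; rewrite mxE ltr01.
apply/matrixP => i k; rewrite mxE [RHS]mxE [const_mx _ _ _]mxE mulr1.
transitivity (\sum_(j | j != i) (1 : R)); last first.
  by rewrite sumr_const; congr (_ *+ _); rewrite cardC1 card_ord.
rewrite (bigID (fun j => j == i)) /= [X in X + _]big1 ?add0r.
  apply: eq_bigr => j ji; rewrite [const_mx _ _ _]mxE mulr1.
  rewrite (ZmxE uniform_owner) // !mxE !so eqxx (negbTE ji) opprK divr1.
  by apply/max_l; exact: ler01.
move=> j /eqP ->; rewrite (ZmxE uniform_owner) // [X in X / _]mxE mxE so eqxx.
by rewrite max_r ?mul0r // oppr_le0 ler01.
Qed.

Lemma uniform_gpf_root : (0 < n)%N -> system g ->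
  gpf_root uniform_gains n.-1%:R.
Proof.
move=> n0 sys; have [s so] := exists_selection ownP sys; split.
  exists (sel_mx s); last exact: uniform_perron_root.
  by apply/legal_sel/(owner_sel uniform_owner).
move=> F /legal_selP[t -> /(owner_sel uniform_owner) to].
by exists n.-1%:R => //; exact: uniform_perron_root.
Qed.

(** Two selections that differ at one entity are both optimal, and an affector
    chosen by just one of them separates their vectors. *)
Lemma uniform_not_unique : (0 < n)%N -> system g -> irreducible_system g ->
  ~ square_system g ->
  [/\ system uniform_gains, irreducible_system uniform_gains,
      ~ square_system uniform_gains
    & exists P1 P2, [/\ gpf_vector uniform_gains P1,
        gpf_vector uniform_gains P2 & P1 <> P2]].
Proof.
move=> n0 sys irr nsq; have irr' := uniform_irreducible irr.
split => //.
- case: sys => [sup nored]; split=> [i|j]; first by rewrite uniform_supporters.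
  by have [i ji] := nored j; exists i; rewrite uniform_supporters.
- case=> [le_mn one]; apply: nsq; split=> // i.
  by rewrite -uniform_supporters.
have [s so] := exists_selection ownP sys.
have [j sj] := nonsquare_second_supporter ownP nsq so.
have gr := uniform_gpf_root n0 sys.
have [P1 [gP1 _ P1j]] :=
  gpf_vector_exists uniform_owner n0 irr' gr so (uniform_perron_root n0 so).
have to := own_reselect j so.
have [P2 [gP2 P2s _]] :=
  gpf_vector_exists uniform_owner n0 irr' gr to (uniform_perron_root n0 to).
exists P1, P2; split => // P12; have := P2s (own j).
rewrite ffunE eqxx -P12 P1j ?ltxx // => i.
by apply: contraNneq sj => <-; rewrite so.
Qed.

End UniformGains.

End Selections.

(** * Generalized Perron-Frobenius theorem *)

Theorem theorem3p9 (R : realType) (n m : nat) (g : 'M[R]_(n, m))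
    (n_gt0 : (0 < n)%N) (le_nm : (n <= m)%N)
    (g_sys : system g) (g_irr : irreducible_system g)
    (g_nonsquare : ~ square_system g) :
  (* r(L) and P(L) exist *)
  (exists r, gpf_root g r) /\ (exists P, gpf_vector g P) /\
  forall (r : R) (P : 'cV[R]_m), gpf_root g r -> gpf_vector g P ->
    (* Q1 *)
    0 < r /\
    (* Q2 *)
    (forall j, 0 <= P j 0) /\
    (* Q3 *)
    #|NZ P| = n /\
    (* Q4 : uniqueness fails in general *)
    (exists g' : 'M[R]_(n, m),
       [/\ system g', irreducible_system g', ~ square_system g'
         & exists P1 P2, [/\ gpf_vector g' P1, gpf_vector g' P2 & P1 <> P2]]) /\
    (* Q5 : Collatz-Wielandt formula *)
    ((exists2 X, cw_domain g X & cw g X = r%:E) /\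
     (forall X, cw_domain g X -> (r%:E <= cw g X)%E)) /\
    (* Q5 : optimization program *)
    exists beta : R,
      [/\ r = beta^-1,
          optimal g beta P
        & forall X, optimal g beta X -> forall i,
            (Mminus g *m X) i 0 = beta^-1 * (Mplus g *m X) i 0].
Proof.
have [own ownP] := exists_owner g_sys g_irr.
have [rho grho] := gpf_root_exists ownP n_gt0 g_sys g_irr.
split; first by exists rho.
split.
  have [[F /legal_selP[s -> /(owner_sel ownP) so] Zs] _] := grho.
  have [P [gP _ _]] := gpf_vector_exists ownP n_gt0 g_irr grho so Zs.
  by exists P.
move=> r P gr gP; have [r0 _] := dual_certificate ownP n_gt0 g_irr gr.
have [s [p [so PE p0 _ Pr]]] := gpf_vectorP ownP gr gP.
have Popt := gpf_vector_optimal ownP n_gt0 g_irr gr gP.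
have [[_ _ P0 P1] _] := Popt.
have MP i : 0 < (Mplus g *m P) i 0 by rewrite PE; exact: Mplus_mul_sel_gt0.
split=> //; split=> //; split; first by rewrite PE (NZ_mul_sel so).
split; first by exists (uniform_gains R own); exact: uniform_not_unique ownP _ _ _ _.
split.
  split; last by move=> X; exact: gpf_root_le_cw.
  exists P; last exact: cw_eigenvector.
  split=> //; apply: contraTneq (MP (Ordinal n_gt0)) => ->.
  by rewrite mxE ltxx.
exists r^-1; split=> // [|X [[_ Xr X0 _] _]]; rewrite invrK //.
by apply: (complementary_slackness ownP) => // i; have := Xr i; rewrite invrK.
Qed.
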